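(* Let $X=\mathbb{P}^1\times\mathbb{P}^2$ with projections $\pi_1:X\to\mathbb{P}^1$ and $\pi_2:X\to\mathbb{P}^2$. The following maps are bijections (on isomorphism classes): 1. $\mathcal{F}\mapsto\pi_1^*(\mathcal{F})$, from the spanned vector bundles of rank $r$ on $\mathbb{P}^1$ of degree $a$ to the spanned vector bundles of rank $r$ on $X$ with $c_1=(a,0)$; 2. $\mathcal{F}\mapsto\pi_2^*(\mathcal{F})$, from the spanned vector bundles of rank $r$ on $\mathbb{P}^2$ with $c_1=b$ to the spanned vector bundles of rank $r$ on $X$ with $c_1=(0,b)$.
   Context: Work over an algebraically closed field of characteristic $0$. ''Spanned'' means globally generated. The class $c_1(\pi_1^*\mathcal{O}_{\mathbb{P}^1}(a)\otimes\pi_2^*\mathcal{O}_{\mathbb{P}^2}(b))$ on $X$ is written $(a,b)$. Here $a,b$ are non-negative integers and $r$ is a positive integer. *)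

(* Defs.v *)
From HB Require Import structures.
From mathcomp Require Import all_boot all_order all_algebra.
From mathcomp Require Import classical_sets functions.
From mathcomp Require Import mpoly.

Set Implicit Arguments.
Unset Strict Implicit.
Unset Printing Implicit Defensive.

Import GRing.Theory.
Local Open Scope ring_scope.
Local Open Scope classical_set_scope.

(* Classical (pre)varieties over K are handled as spaces with functions: a
   topological space with a sheaf of K-valued functions whose non-vanishing
   loci are open and which is closed under inversion there.  The predicate
   [freg U] is meaningful for open U only and ignores values outside U. *)
Record funspace (K : fieldType) := FunSpace {
  fcarrier :> Type;
  fopen : set (set fcarrier);
  freg : set fcarrier -> set (fcarrier -> K);
  fopenT : fopen setT;
  fopenI : forall U V, fopen U -> fopen V -> fopen (U `&` V);
  fopen_bigcup : forall F : set (set fcarrier),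
    F `<=` fopen -> fopen (\bigcup_(U in F) U);
  freg_eq : forall U phi psi, (forall x, U x -> phi x = psi x) ->
    freg U phi -> freg U psi;
  freg_sub : forall U V phi, fopen U -> fopen V -> V `<=` U ->
    freg U phi -> freg V phi;
  freg_glue : forall U phi, fopen U ->
    (forall x, U x -> exists V, [/\ fopen V, V x, V `<=` U & freg V phi]) ->
    freg U phi;
  freg_cst : forall U c, fopen U -> freg U (fun=> c);
  fregD : forall U phi psi, fopen U -> freg U phi -> freg U psi ->
    freg U (fun x => phi x + psi x);
  fregM : forall U phi psi, fopen U -> freg U phi -> freg U psi ->
    freg U (fun x => phi x * psi x);
  fopen_neq0 : forall U phi, fopen U -> freg U phi ->
    fopen [set x | U x /\ phi x != 0];
  fregV : forall U phi, fopen U -> freg U phi ->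
    freg [set x | U x /\ phi x != 0] (fun x => (phi x)^-1)
}.

Record morphism (K : fieldType) (X Y : funspace K) := Morphism {
  mfun :> X -> Y;
  morph_open : forall V, fopen V -> fopen (mfun @^-1` V);
  morph_reg : forall V phi, fopen V -> freg V phi ->
    freg (mfun @^-1` V) (phi \o mfun)
}.

Section ProjectiveSpace.
Variables (K : fieldType) (n : nat).

(* P^n is the set of lines in K^(n+1). *)
Definition pspace := {L : {vspace 'rV[K]_n.+1} | \dim L == 1%N}.

(* Homogeneous coordinates of a point: [vpick L] is a nonzero vector of L.
   Non-vanishing of a form, and quotients of forms of the same degree, do not
   depend on this choice. *)
Definition hcoord (L : pspace) : 'I_n.+1 -> K := fun i => vpick (val L) 0 i.

Definition hval (p : {mpoly K[n.+1]}) (L : pspace) : K := p.@[hcoord L].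

Definition pspace_open (U : set pspace) : Prop :=
  forall L, U L -> exists d (q : {mpoly K[n.+1]}),
    [/\ q \is d.-homog, hval q L != 0 & [set M | hval q M != 0] `<=` U].

Definition pspace_reg (U : set pspace) (phi : pspace -> K) : Prop :=
  forall L, U L -> exists d (p q : {mpoly K[n.+1]}),
    [/\ p \is d.-homog, q \is d.-homog, hval q L != 0 &
        forall M, U M -> hval q M != 0 -> phi M = hval p M / hval q M].

Lemma hval1 L : hval 1 L = 1. Proof. exact: meval1. Qed.

Lemma hvalM p q L : hval (p * q) L = hval p L * hval q L.
Proof. exact: mevalM. Qed.

Lemma hvalD p q L : hval (p + q) L = hval p L + hval q L.
Proof. exact: mevalD. Qed.

Lemma pspace_openT : pspace_open setT.
Proof.
move=> L _; exists 0%N, 1; split => //; first exact: dhomog1.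
by rewrite hval1 oner_neq0.
Qed.

Lemma pspace_openI U V :
  pspace_open U -> pspace_open V -> pspace_open (U `&` V).
Proof.
move=> oU oV L [/oU[d [q [hq qL sU]]] /oV[e [s [hs sL sV]]]].
exists (d + e)%N, (q * s); split; first exact: dhomogM.
  by rewrite hvalM mulf_neq0.
move=> M /=; rewrite hvalM mulf_eq0 negb_or => /andP[qM sM].
by split; [exact: sU|exact: sV].
Qed.

Lemma pspace_open_bigcup (F : set (set pspace)) :
  F `<=` pspace_open -> pspace_open (\bigcup_(U in F) U).
Proof.
move=> oF L [U FU UL]; have [d [q [hq qL sU]]] := oF _ FU _ UL.
by exists d, q; split => // M /sU UM; exists U.
Qed.

Lemma pspace_reg_eq U phi psi : (forall x, U x -> phi x = psi x) ->
  pspace_reg U phi -> pspace_reg U psi.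
Proof.
move=> eqU rp L UL; have [d [p [q [hp hq qL e]]]] := rp L UL.
by exists d, p, q; split=> // M UM qM; rewrite -eqU// e.
Qed.

Lemma pspace_reg_sub U V phi : pspace_open U -> pspace_open V -> V `<=` U ->
  pspace_reg U phi -> pspace_reg V phi.
Proof.
move=> _ _ VU rp L VL; have [d [p [q [hp hq qL e]]]] := rp L (VU _ VL).
by exists d, p, q; split=> // M /VU; exact: e.
Qed.

Lemma pspace_reg_glue U phi : pspace_open U ->
  (forall x, U x ->
    exists V, [/\ pspace_open V, V x, V `<=` U & pspace_reg V phi]) ->
  pspace_reg U phi.
Proof.
move=> _ h L UL; have [V [oV VL VU rV]] := h L UL.
have [d [p [q [hp hq qL e]]]] := rV L VL.
have [f [s [hs sL sV]]] := oV L VL.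
exists (d + f)%N, (p * s), (q * s); split; rewrite ?dhomogM//.
  by rewrite hvalM mulf_neq0.
move=> M UM; rewrite !hvalM mulf_eq0 negb_or => /andP[qM sM].
by rewrite e//; [rewrite -mulf_div divff// mulr1|exact: sV].
Qed.

Lemma pspace_reg_cst U c : pspace_open U -> pspace_reg U (fun=> c).
Proof.
move=> _ L UL; exists 0%N, c%:MP, 1; split.
- by rewrite -[c%:MP]mulr1 mul_mpolyC rpredZ//; exact: dhomog1.
- exact: dhomog1.
- by rewrite hval1 oner_neq0.
- by move=> M _ _; rewrite hval1 divr1 /hval mevalC.
Qed.

Lemma pspace_regD U phi psi : pspace_open U -> pspace_reg U phi ->
  pspace_reg U psi -> pspace_reg U (fun x => phi x + psi x).
Proof.
move=> _ rp rq L UL; have [d [p [q [hp hq qL e]]]] := rp L UL.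
have [d' [p' [q' [hp' hq' qL' e']]]] := rq L UL.
exists (d + d')%N, (p * q' + p' * q), (q * q'); split.
- by apply: rpredD; [|rewrite addnC]; exact: dhomogM.
- exact: dhomogM.
- by rewrite hvalM mulf_neq0.
- move=> M UM; rewrite hvalD !hvalM mulf_eq0 negb_or => /andP[qM qM'].
  by rewrite e// e'// addf_div.
Qed.

Lemma pspace_regM U phi psi : pspace_open U -> pspace_reg U phi ->
  pspace_reg U psi -> pspace_reg U (fun x => phi x * psi x).
Proof.
move=> _ rp rq L UL; have [d [p [q [hp hq qL e]]]] := rp L UL.
have [d' [p' [q' [hp' hq' qL' e']]]] := rq L UL.
exists (d + d')%N, (p * p'), (q * q'); split; rewrite ?dhomogM//.
  by rewrite hvalM mulf_neq0.
move=> M UM; rewrite !hvalM mulf_eq0 negb_or => /andP[qM qM'].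
by rewrite e// e'// mulf_div.
Qed.

Lemma pspace_open_neq0 U phi : pspace_open U -> pspace_reg U phi ->
  pspace_open [set x | U x /\ phi x != 0].
Proof.
move=> oU rp L [UL pL]; have [d [p [q [hp hq qL e]]]] := rp L UL.
have [f [s [hs sL sU]]] := oU L UL.
have hvp : hval p L != 0.
  by move: pL; rewrite e// mulf_eq0 negb_or => /andP[].
exists (d + d + f)%N, (p * q * s); split; rewrite ?dhomogM//.
  by rewrite !hvalM !mulf_neq0.
move=> M /=; rewrite !hvalM !mulf_eq0 !negb_or => /andP[/andP[pM qM] /sU UM].
by split=> //; rewrite e// mulf_neq0// invr_eq0.
Qed.

Lemma pspace_regV U phi : pspace_open U -> pspace_reg U phi ->
  pspace_reg [set x | U x /\ phi x != 0] (fun x => (phi x)^-1).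
Proof.
move=> _ rp L [UL pL]; have [d [p [q [hp hq qL e]]]] := rp L UL.
have hvp : hval p L != 0.
  by move: pL; rewrite e// mulf_eq0 negb_or => /andP[].
exists (d + d)%N, (q * q), (p * q); split; rewrite ?dhomogM//.
  by rewrite !hvalM mulf_neq0.
move=> M [UM pM]; rewrite !hvalM mulf_eq0 negb_or => /andP[hpM qM].
by rewrite e// invf_div -mulf_div divff// mulr1.
Qed.

Definition proj_space : funspace K :=
  FunSpace pspace_openT pspace_openI pspace_open_bigcup pspace_reg_eq
    pspace_reg_sub pspace_reg_glue pspace_reg_cst pspace_regD pspace_regM
    pspace_open_neq0 pspace_regV.

End ProjectiveSpace.

(* The product of prevarieties.  Its topology is finer than the product
   topology: a basis is given by the loci D != 0 in boxes U x V, for D in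
   O(U) (x) O(V); regular functions are locally quotients of elements of
   O(U) (x) O(V). *)
Section Product.
Variables (K : fieldType) (X Y : funspace K).

Definition tensfun (U : set X) (V : set Y) (f : X * Y -> K) : Prop :=
  exists (I : finType) (g : I -> X -> K) (h : I -> Y -> K),
    [/\ forall i, freg U (g i), forall i, freg V (h i) &
        forall z, U z.1 -> V z.2 -> f z = \sum_i g i z.1 * h i z.2].

Definition prod_open (W : set (X * Y)) : Prop :=
  forall z, W z -> exists U V D,
    [/\ fopen U /\ fopen V, U z.1 /\ V z.2, tensfun U V D, D z != 0 &
        forall w, U w.1 -> V w.2 -> D w != 0 -> W w].

Definition prod_reg (W : set (X * Y)) (phi : X * Y -> K) : Prop :=
  forall z, W z -> exists U V N D,
    [/\ fopen U /\ fopen V, U z.1 /\ V z.2, tensfun U V N /\ tensfun U V D,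
        D z != 0 &
        forall w, W w -> U w.1 -> V w.2 -> D w != 0 -> phi w = N w / D w].

Lemma tensfun_sub U V U' V' f : fopen U -> fopen V -> fopen U' -> fopen V' ->
  U' `<=` U -> V' `<=` V -> tensfun U V f -> tensfun U' V' f.
Proof.
move=> oU oV oU' oV' sU sV [I [g [h [rg rh e]]]]; exists I, g, h; split.
- by move=> i; apply: freg_sub (rg i).
- by move=> i; apply: freg_sub (rh i).
- by move=> z /sU ? /sV ?; exact: e.
Qed.

Lemma tensfun_box U V U' V' f g : fopen U -> fopen V -> fopen U' -> fopen V' ->
  tensfun U V f -> tensfun U' V' g ->
  tensfun (U `&` U') (V `&` V') f /\ tensfun (U `&` U') (V `&` V') g.
Proof.
move=> oU oV oU' oV' tf tg; split.
- by apply: tensfun_sub tf => //; try apply: fopenI => //; move=> x [].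
- by apply: tensfun_sub tg => //; try apply: fopenI => //; move=> x [].
Qed.

Lemma tensfun_fst U V f : fopen U -> fopen V -> freg U f ->
  tensfun U V (f \o fst).
Proof.
move=> oU oV rf; exists unit, (fun=> f), (fun=> fun=> 1); split => //.
- by move=> _; exact: freg_cst.
- by move=> z _ _; rewrite (big_pred1 tt) ?mulr1//; case.
Qed.

Lemma tensfun_snd U V f : fopen U -> fopen V -> freg V f ->
  tensfun U V (f \o snd).
Proof.
move=> oU oV rf; exists unit, (fun=> fun=> 1), (fun=> f); split => //.
- by move=> _; exact: freg_cst.
- by move=> z _ _; rewrite (big_pred1 tt) ?mul1r//; case.
Qed.

Lemma tensfun_cst U V c : fopen U -> fopen V -> tensfun U V (fun=> c).
Proof.
by move=> oU oV; apply: (@tensfun_fst U V (fun=> c)) => //; exact: freg_cst.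
Qed.

Lemma tensfunD U V f g : tensfun U V f -> tensfun U V g ->
  tensfun U V (fun z => f z + g z).
Proof.
move=> [I [a [b [ra rb e]]]] [J [c [d [rc rd e']]]].
exists (I + J)%type, (fun k => match k with inl i => a i | inr j => c j end),
  (fun k => match k with inl i => b i | inr j => d j end).
split; [by case|by case|].
by move=> z Uz Vz; rewrite e// e'// big_sumType.
Qed.

Lemma tensfunM U V f g : fopen U -> fopen V -> tensfun U V f ->
  tensfun U V g -> tensfun U V (fun z => f z * g z).
Proof.
move=> oU oV [I [a [b [ra rb e]]]] [J [c [d [rc rd e']]]].
exists (I * J)%type, (fun k x => a k.1 x * c k.2 x),
  (fun k y => b k.1 y * d k.2 y).
split; [by move=> k; exact: fregM|by move=> k; exact: fregM|].
move=> z Uz Vz; rewrite e// e'// big_distrlr /= pair_big /=.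
by apply: eq_bigr => k _; rewrite mulrACA.
Qed.

Lemma prod_openT : prod_open setT.
Proof.
move=> z _; exists setT, setT, (fun=> 1); split=> //; last exact: oner_neq0.
- by split; exact: fopenT.
- by apply: tensfun_cst; exact: fopenT.
Qed.

Lemma prod_openI W W' : prod_open W -> prod_open W' -> prod_open (W `&` W').
Proof.
move=> oW oW' z [/oW[U [V [D [[oU oV] [Uz Vz] tD Dz sW]]]]].
move=> /oW'[U' [V' [D' [[oU' oV'] [Uz' Vz'] tD' Dz' sW']]]].
have [t1 t2] := tensfun_box oU oV oU' oV' tD tD'.
exists (U `&` U'), (V `&` V'), (fun z => D z * D' z); split.
- by split; exact: fopenI.
- by split; split.
- by apply: tensfunM => //; exact: fopenI.
- by rewrite mulf_neq0.
- move=> w [? ?] [? ?]; rewrite mulf_eq0 negb_or => /andP[? ?].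
  by split; [exact: sW|exact: sW'].
Qed.

Lemma prod_open_bigcup (F : set (set (X * Y))) :
  F `<=` prod_open -> prod_open (\bigcup_(U in F) U).
Proof.
move=> oF z [W FW Wz]; have [U [V [D [oUV zUV tD Dz sW]]]] := oF _ FW _ Wz.
by exists U, V, D; split=> // w *; exists W => //; exact: sW.
Qed.

Lemma prod_reg_eq W phi psi : (forall z, W z -> phi z = psi z) ->
  prod_reg W phi -> prod_reg W psi.
Proof.
move=> eW rp z Wz; have [U [V [N [D [oUV zUV tND Dz e]]]]] := rp z Wz.
by exists U, V, N, D; split=> // w Ww *; rewrite -eW// e.
Qed.

Lemma prod_reg_sub W W' phi : prod_open W -> prod_open W' -> W' `<=` W ->
  prod_reg W phi -> prod_reg W' phi.
Proof.
move=> _ _ sW rp z Wz; have [U [V [N [D [oUV zUV tND Dz e]]]]] := rp z (sW _ Wz).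
by exists U, V, N, D; split=> // w /sW Ww *; rewrite e.
Qed.

Lemma prod_reg_glue W phi : prod_open W ->
  (forall z, W z -> exists W', [/\ prod_open W', W' z, W' `<=` W &
    prod_reg W' phi]) -> prod_reg W phi.
Proof.
move=> _ h z Wz; have [W' [oW' Wz' sW rW]] := h z Wz.
have [U [V [N [D [[oU oV] [Uz Vz] [tN tD] Dz e]]]]] := rW z Wz'.
have [U' [V' [D' [[oU' oV'] [Uz' Vz'] tD' Dz' sW']]]] := oW' z Wz'.
have [tN1 tD1] := tensfun_box oU oV oU' oV' tN tD'.
have [tD2 _] := tensfun_box oU oV oU' oV' tD tD'.
exists (U `&` U'), (V `&` V'), (fun z => N z * D' z), (fun z => D z * D' z).
split.
- by split; exact: fopenI.
- by split; split.
- by split; apply: tensfunM => //; exact: fopenI.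
- by rewrite mulf_neq0.
- move=> w Ww [Uw Uw'] [Vw Vw']; rewrite mulf_eq0 negb_or => /andP[Dw Dw'].
  by rewrite e//; [rewrite -mulf_div divff// mulr1|exact: sW'].
Qed.

Lemma prod_reg_cst W c : prod_open W -> prod_reg W (fun=> c).
Proof.
move=> _ z Wz; exists setT, setT, (fun=> c), (fun=> 1); split=> //.
- by split; exact: fopenT.
- by split; apply: tensfun_cst; exact: fopenT.
- exact: oner_neq0.
- by move=> *; rewrite divr1.
Qed.

Lemma prod_regD W phi psi : prod_open W -> prod_reg W phi ->
  prod_reg W psi -> prod_reg W (fun z => phi z + psi z).
Proof.
move=> _ rp rq z Wz.
have [U [V [N [D [[oU oV] [Uz Vz] [tN tD] Dz e]]]]] := rp z Wz.
have [U' [V' [N' [D' [[oU' oV'] [Uz' Vz'] [tN' tD'] Dz' e']]]]] := rq z Wz.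
have [tN1 tN1'] := tensfun_box oU oV oU' oV' tN tN'.
have [tD1 tD1'] := tensfun_box oU oV oU' oV' tD tD'.
have oUU := fopenI oU oU'; have oVV := fopenI oV oV'.
exists (U `&` U'), (V `&` V'), (fun z => N z * D' z + N' z * D z),
  (fun z => D z * D' z); split => //.
- by split; [apply: tensfunD|]; apply: tensfunM.
- by rewrite mulf_neq0.
- move=> w Ww [Uw Uw'] [Vw Vw']; rewrite mulf_eq0 negb_or => /andP[Dw Dw'].
  by rewrite e// e'// addf_div.
Qed.

Lemma prod_regM W phi psi : prod_open W -> prod_reg W phi ->
  prod_reg W psi -> prod_reg W (fun z => phi z * psi z).
Proof.
move=> _ rp rq z Wz.
have [U [V [N [D [[oU oV] [Uz Vz] [tN tD] Dz e]]]]] := rp z Wz.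
have [U' [V' [N' [D' [[oU' oV'] [Uz' Vz'] [tN' tD'] Dz' e']]]]] := rq z Wz.
have [tN1 tN1'] := tensfun_box oU oV oU' oV' tN tN'.
have [tD1 tD1'] := tensfun_box oU oV oU' oV' tD tD'.
have oUU := fopenI oU oU'; have oVV := fopenI oV oV'.
exists (U `&` U'), (V `&` V'), (fun z => N z * N' z),
  (fun z => D z * D' z); split => //.
- by split; apply: tensfunM.
- by rewrite mulf_neq0.
- move=> w Ww [Uw Uw'] [Vw Vw']; rewrite mulf_eq0 negb_or => /andP[Dw Dw'].
  by rewrite e// e'// mulf_div.
Qed.

Lemma prod_open_neq0 W phi : prod_open W -> prod_reg W phi ->
  prod_open [set z | W z /\ phi z != 0].
Proof.
move=> oW rp z [Wz pz].
have [U [V [N [D [[oU oV] [Uz Vz] [tN tD] Dz e]]]]] := rp z Wz.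
have [U' [V' [D' [[oU' oV'] [Uz' Vz'] tD' Dz' sW']]]] := oW z Wz.
have Nz : N z != 0.
  by move: pz; rewrite e// mulf_eq0 negb_or => /andP[].
have [tN1 tD1'] := tensfun_box oU oV oU' oV' tN tD'.
have [tD1 _] := tensfun_box oU oV oU' oV' tD tD'.
have oUU := fopenI oU oU'; have oVV := fopenI oV oV'.
exists (U `&` U'), (V `&` V'), (fun z => N z * D z * D' z); split => //.
- by do 2 apply: tensfunM => //.
- by rewrite !mulf_neq0.
- move=> w [Uw Uw'] [Vw Vw']; rewrite !mulf_eq0 !negb_or.
  move=> /andP[/andP[Nw Dw] Dw']; have Ww := sW' w Uw' Vw' Dw'.
  by split=> //; rewrite e// mulf_neq0// invr_eq0.
Qed.

Lemma prod_regV W phi : prod_open W -> prod_reg W phi ->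
  prod_reg [set z | W z /\ phi z != 0] (fun z => (phi z)^-1).
Proof.
move=> _ rp z [Wz pz].
have [U [V [N [D [[oU oV] [Uz Vz] [tN tD] Dz e]]]]] := rp z Wz.
have Nz : N z != 0.
  by move: pz; rewrite e// mulf_eq0 negb_or => /andP[].
exists U, V, (fun z => D z * D z), (fun z => N z * D z); split => //.
- by split; apply: tensfunM.
- by rewrite mulf_neq0.
- move=> w [Ww pw] Uw Vw; rewrite mulf_eq0 negb_or => /andP[Nw Dw].
  by rewrite e// invf_div -mulf_div divff// mulr1.
Qed.

Definition prod_space : funspace K :=
  FunSpace prod_openT prod_openI prod_open_bigcup prod_reg_eq prod_reg_sub
    prod_reg_glue prod_reg_cst prod_regD prod_regM prod_open_neq0 prod_regV.

Lemma fst_open U : fopen U -> prod_open (fst @^-1` U).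
Proof.
move=> oU z Uz; exists U, setT, (fun=> 1); split=> //; last exact: oner_neq0.
- by split=> //; exact: fopenT.
- by apply: tensfun_cst => //; exact: fopenT.
Qed.

Lemma fst_reg U phi : fopen U -> freg U phi ->
  prod_reg (fst @^-1` U) (phi \o fst).
Proof.
move=> oU rp z Uz; exists U, setT, (phi \o fst), (fun=> 1); split=> //.
- by split=> //; exact: fopenT.
- split; last by apply: tensfun_cst => //; exact: fopenT.
  by apply: tensfun_fst => //; exact: fopenT.
- exact: oner_neq0.
- by move=> *; rewrite divr1.
Qed.

Definition prod_fst : morphism prod_space X :=
  @Morphism K prod_space X fst fst_open fst_reg.

Lemma snd_open V : fopen V -> prod_open (snd @^-1` V).
Proof.
move=> oV z Vz; exists setT, V, (fun=> 1); split=> //; last exact: oner_neq0.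
- by split=> //; exact: fopenT.
- by apply: tensfun_cst => //; exact: fopenT.
Qed.

Lemma snd_reg V phi : fopen V -> freg V phi ->
  prod_reg (snd @^-1` V) (phi \o snd).
Proof.
move=> oV rp z Vz; exists setT, V, (phi \o snd), (fun=> 1); split=> //.
- by split=> //; exact: fopenT.
- split; last by apply: tensfun_cst => //; exact: fopenT.
  by apply: tensfun_snd => //; exact: fopenT.
- exact: oner_neq0.
- by move=> *; rewrite divr1.
Qed.

Definition prod_snd : morphism prod_space Y :=
  @Morphism K prod_space Y snd snd_open snd_reg.

End Product.

Definition mxreg (K : fieldType) (X : funspace K) (m n : nat) (U : set X)
    (A : X -> 'M[K]_(m, n)) : Prop :=
  forall i j, freg U (fun x => A x i j).

(* A vector bundle of rank r, presented by a trivializing open cover and its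
   transition matrices.  The cover consists of a trivializing neighbourhood
   [vb_dom p] of each point p (the neighbourhoods of distinct points may
   coincide): any locally trivial bundle has such a presentation, and covers
   indexed by the points of X keep [set (vbundle X r)] within the universe
   bounds of [set].  A section with local expressions s_p : U_p -> K^r satisfies
   s_p = g_pq s_q on the intersection of U_p and U_q. *)
Record vbundle (K : fieldType) (X : funspace K) (r : nat) := VBundle {
  vb_dom : X -> set X;
  vb_trans : X -> X -> X -> 'M[K]_r;
  vb_open : forall p, fopen (vb_dom p);
  vb_mem : forall p, vb_dom p p;
  vb_reg : forall p q, mxreg (vb_dom p `&` vb_dom q) (vb_trans p q);
  vb_id : forall p x, vb_dom p x -> vb_trans p p x = 1%:M;
  vb_cocycle : forall p q t x, vb_dom p x -> vb_dom q x -> vb_dom t x ->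
    vb_trans p q x *m vb_trans q t x = vb_trans p t x
}.

Section Bundles.
Variables (K : fieldType).
Implicit Types X Y : funspace K.

(* Isomorphisms are given by their matrices h_qp, from the trivialization of
   E over U_p to that of F over V_q. *)
Definition vb_iso X r (E F : vbundle X r) : Prop :=
  exists h : X -> X -> X -> 'M[K]_r,
  [/\ forall q p, mxreg (vb_dom F q `&` vb_dom E p) (h q p),
      forall q p x, vb_dom F q x -> vb_dom E p x -> h q p x \in unitmx &
      forall q q' p' p x,
        vb_dom F q x -> vb_dom F q' x -> vb_dom E p' x -> vb_dom E p x ->
        vb_trans F q q' x *m h q' p' x *m vb_trans E p' p x = h q p x].

Definition vb_section X r (E : vbundle X r) (s : X -> X -> 'cV[K]_r) : Prop :=
  (forall p, mxreg (vb_dom E p) (s p)) /\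
  (forall p q x, vb_dom E p x -> vb_dom E q x ->
    s p x = vb_trans E p q x *m s q x).

(* Globally generated: evaluation of global sections is onto every fibre, the
   fibre at x being read in any trivialization around x. *)
Definition spanned X r (E : vbundle X r) : Prop :=
  forall p x (v : 'cV[K]_r), vb_dom E p x ->
    exists2 s, vb_section E s & s p x = v.

Definition pullback X Y (f : morphism X Y) r (E : vbundle Y r) : vbundle X r.
Proof.
apply: (@VBundle K X r (fun p => f @^-1` vb_dom E (f p))
  (fun p q => vb_trans E (f p) (f q) \o f)).
- by move=> p; apply: morph_open; exact: vb_open.
- by move=> p; exact: vb_mem.
- move=> p q a b.
  exact: (morph_reg f (fopenI (vb_open E (f p)) (vb_open E (f q)))
                      (vb_reg E (f p) (f q) a b)).
- by move=> p x; exact: vb_id.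
- by move=> p q t x; exact: vb_cocycle.
Defined.

Lemma freg_sum X (U : set X) (I : finType) (P : pred I) (F : I -> X -> K) :
  fopen U -> (forall i, freg U (F i)) ->
  freg U (fun x => \sum_(i | P i) F i x).
Proof.
move=> oU rF; elim: (index_enum I) => [|i s IHs].
  by apply: freg_eq (freg_cst 0 oU) => x _; rewrite big_nil.
case Pi : (P i).
  by apply: freg_eq (fregD oU (rF i) IHs) => x _; rewrite big_cons Pi.
by apply: freg_eq IHs => x _; rewrite big_cons Pi.
Qed.

Lemma freg_prod X (U : set X) (I : finType) (F : I -> X -> K) :
  fopen U -> (forall i, freg U (F i)) -> freg U (fun x => \prod_i F i x).
Proof.
move=> oU rF; elim: (index_enum I) => [|i s IHs].
  by apply: freg_eq (freg_cst 1 oU) => x _; rewrite big_nil.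
by apply: freg_eq (fregM oU (rF i) IHs) => x _; rewrite big_cons.
Qed.

Lemma freg_det X (U : set X) r (A : X -> 'M[K]_r) :
  fopen U -> mxreg U A -> freg U (fun x => \det (A x)).
Proof.
move=> oU rA; rewrite /determinant; apply: freg_sum => // s.
by apply: fregM => //; [exact: freg_cst|exact: freg_prod].
Qed.

(* The top exterior power, as a line bundle. *)
Definition det_bundle X r (E : vbundle X r) : vbundle X 1.
Proof.
apply: (@VBundle K X 1 (vb_dom E) (fun p q x => (\det (vb_trans E p q x))%:M)).
- by move=> p; exact: vb_open.
- by move=> p; exact: vb_mem.
- move=> p q a b; apply: freg_eq (freg_det _ (vb_reg E p q)).
    by move=> x _; rewrite !ord1 mxE eqxx mulr1n.
  by apply: fopenI; exact: vb_open.
- by move=> p x Ux; rewrite vb_id// det1.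
- by move=> p q t x Up Uq Ut; rewrite -scalar_mxM -det_mulmx vb_cocycle.
Defined.

Definition tensor_line X (L M : vbundle X 1) : vbundle X 1.
Proof.
apply: (@VBundle K X 1 (fun p => vb_dom L p `&` vb_dom M p)
  (fun p q x => vb_trans L p q x *m vb_trans M p q x)).
- by move=> p; apply: fopenI; exact: vb_open.
- by move=> p; split; exact: vb_mem.
- move=> p q a b.
  have o1 := fopenI (vb_open L p) (vb_open L q).
  have o2 := fopenI (vb_open M p) (vb_open M q).
  have o := fopenI o1 o2; rewrite setIACA.
  have r1 := freg_sub o1 o (@subIsetl _ _ _) (vb_reg L p q a 0).
  have r2 := freg_sub o2 o (@subIsetr _ _ _) (vb_reg M p q 0 b).
  by apply: freg_eq (fregM o r1 r2) => x _; rewrite mxE big_ord1.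
- by move=> p x [Lp Mp]; rewrite !vb_id// mulmx1.
- move=> p q t x [Lp Mp] [Lq Mq] [Lt Mt].
  rewrite -(vb_cocycle Lp Lq Lt) -(vb_cocycle Mp Mq Mt).
  rewrite !mulmxA; congr (_ *m _); rewrite -!mulmxA; congr (_ *m _).
  by rewrite (mx11_scalar (vb_trans L q t x)) scalar_mxC.
Defined.

End Bundles.

Section TwistingSheaf.
Variables (K : fieldType) (n d : nat).
Local Notation P := (proj_space K n).

(* A nonvanishing homogeneous coordinate at L; the standard chart where it does
   not vanish is the trivializing neighbourhood of L. *)
Definition pivot (L : P) : 'I_n.+1 := odflt ord0 [pick i | hcoord L i != 0].

Definition twist_dom (A : P) : set P := [set L | hcoord L (pivot A) != 0].

(* On the chart x_i != 0 a form F of degree d gives the section F / x_i^d, hence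
   the transition functions (x_j / x_i)^d. *)
Definition twist_trans (A B L : P) : 'M[K]_1 :=
  ((hcoord L (pivot B) / hcoord L (pivot A)) ^+ d)%:M.

Lemma pivotP (L : P) : hcoord L (pivot L) != 0.
Proof.
rewrite /pivot; case: pickP => //= L0.
have : vpick (val L) != 0 by rewrite vpick0 -dimv_eq0 (eqP (valP L)).
by case/rV0Pn => i; have := L0 i; rewrite /hcoord => ->.
Qed.

Lemma hvalX (i : 'I_n.+1) (e : nat) (L : pspace K n) :
  hval ('X_i ^+ e) L = hcoord L i ^+ e.
Proof. by rewrite /hval rmorphXn /= mevalXU. Qed.

Lemma homogX (i : 'I_n.+1) e : ('X_i ^+ e : {mpoly K[n.+1]}) \is e.-homog.
Proof.
rewrite -[X in X.-homog]mul1n dhomogMn// dhomogX; apply/eqP; exact: mdeg1.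
Qed.

Definition twist : vbundle P 1.
Proof.
apply: (@VBundle K P 1 twist_dom twist_trans).
- move=> A L /= LA; exists 1%N, ('X_(pivot A) ^+ 1).
  split=> //; first exact: homogX.
    by rewrite hvalX.
  by move=> M /=; rewrite hvalX.
- exact: pivotP.
- move=> A B a b L [/= LA LB].
  exists d, ('X_(pivot B) ^+ d), ('X_(pivot A) ^+ d).
  split; rewrite ?homogX// ?hvalX ?expf_neq0//.
  by move=> M _ _; rewrite !hvalX !ord1 mxE eqxx mulr1n expr_div_n.
- by move=> A L /= LA; rewrite /twist_trans divff// expr1n.
- move=> A B C L /= LA LB LC.
  rewrite /twist_trans -scalar_mxM -exprMn; congr ((_ ^+ _)%:M).
  by rewrite mulrC mulrA divfK.
Defined.

End TwistingSheaf.

Definition iso_class (K : fieldType) (X : funspace K) (r : nat)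
    (E : vbundle X r) : set (vbundle X r) := [set F | vb_iso E F].

(* The first Chern class with values in Pic X: the class of det E. *)
Definition c1 (K : fieldType) (X : funspace K) (r : nat) (E : vbundle X r) :
  set (vbundle X 1) := iso_class (det_bundle E).

(* On P^n, [c1_is E d] reads c_1(E) = d, that is c_1(E) = c_1(O(d)); for n = 1
   this says that E has degree d. *)
Definition c1_is (K : fieldType) (n r : nat)
    (E : vbundle (proj_space K n) r) (d : nat) : Prop :=
  c1 E = c1 (twist K n d).

Definition bitwist (K : fieldType) (m n a b : nat) :
    vbundle (prod_space (proj_space K m) (proj_space K n)) 1 :=
  tensor_line (pullback (prod_fst _ _) (twist K m a))
              (pullback (prod_snd _ _) (twist K n b)).

Definition c1_is2 (K : fieldType) (m n r : nat)
    (E : vbundle (prod_space (proj_space K m) (proj_space K n)) r)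
    (a b : nat) : Prop :=
  c1 E = c1 (bitwist K m n a b).

Definition iso_classes (K : fieldType) (X : funspace K) (r : nat)
    (P : set (vbundle X r)) : set (set (vbundle X r)) :=
  [set iso_class E | E in P].

(* The map induced on isomorphism classes: it sends a class C to the union of
   the classes of f E for E in C, which is the class of f E when f preserves
   isomorphism. *)
Definition class_map (K : fieldType) (X Y : funspace K) (r s : nat)
    (f : vbundle X r -> vbundle Y s) (C : set (vbundle X r)) :
  set (vbundle Y s) := [set G | exists2 E, C E & vb_iso (f E) G].

(* Main.v *)
(* A spanned bundle E on X with det E pulled back from the base Y of a
   projection f : X -> Y has a frame of global sections at any given point x.
   Its determinant is a section of a line bundle pulled back from Y, hence
   constant along the fibre of f through x, because regular functions on a
   projective space are constant; so the frame is a frame along the whole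
   fibre.  Two such frames differ by a matrix of regular functions, again
   constant along the fibre, so that transporting the coordinates in a frame
   S from x to the point g (f x) of a section g of f, by the matrix
   S(g (f x)) S(x)^-1, does not depend on S.  This is an isomorphism from E
   to the pullback by f of the restriction of E to the section.

   For the constancy, a regular function restricted to the line through two
   points [v] and [w] is everywhere locally a rational function in t at
   [v + t w], hence a polynomial F(t); likewise it is a polynomial G(s) at
   [w + s v], and F(t) = G(1/t) forces F and G to be constant. *)
Require Import Defs.
From HB Require Import structures.
From mathcomp Require Import all_boot all_order all_algebra.
From mathcomp Require Import boolp classical_sets functions.
From mathcomp Require Import mpoly.

Set Implicit Arguments.
Unset Strict Implicit.
Unset Printing Implicit Defensive.

Import GRing.Theory.
Local Open Scope ring_scope.
Local Open Scope classical_set_scope.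

(** * Regular matrices and isomorphisms of bundles *)

Section RegularMatrices.
Variable K : fieldType.
Implicit Types X Y : funspace K.

Lemma fopen_local X (U : set X) :
  (forall x, U x -> exists V, [/\ fopen V, V x & V `<=` U]) -> fopen U.
Proof.
move=> locU.
have -> : U = \bigcup_(V in [set V | fopen V /\ V `<=` U]) V.
  apply/seteqP; split=> x; last by case=> V [_ VU] /VU.
  by move=> /locU[V [oV Vx VU]]; exists V.
by apply: fopen_bigcup => V [].
Qed.

Lemma mxreg_eq X m n (U : set X) (A B : X -> 'M[K]_(m, n)) :
  (forall x, U x -> A x = B x) -> mxreg U A -> mxreg U B.
Proof. by move=> eAB rA i j; apply: freg_eq (rA i j) => x /eAB ->. Qed.

Lemma mxreg_sub X m n (U V : set X) (A : X -> 'M[K]_(m, n)) :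
  fopen U -> fopen V -> V `<=` U -> mxreg U A -> mxreg V A.
Proof. by move=> oU oV VU rA i j; apply: freg_sub (rA i j). Qed.

Lemma mxreg_glue X m n (U : set X) (A : X -> 'M[K]_(m, n)) : fopen U ->
  (forall x, U x -> exists V, [/\ fopen V, V x, V `<=` U & mxreg V A]) ->
  mxreg U A.
Proof.
move=> oU locA i j; apply: freg_glue => // x /locA[V [oV Vx VU rA]].
by exists V; split=> //; exact: rA.
Qed.

Lemma mxreg_mul X m n p (U : set X) (A : X -> 'M[K]_(m, n))
    (B : X -> 'M[K]_(n, p)) :
  fopen U -> mxreg U A -> mxreg U B -> mxreg U (fun x => A x *m B x).
Proof.
move=> oU rA rB i j.
apply: (@freg_eq _ _ _ (fun x => \sum_k A x i k * B x k j)).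
  by move=> x _; rewrite mxE.
by apply: freg_sum => // k; apply: fregM.
Qed.

Lemma fopen_unit X n (U : set X) (A : X -> 'M[K]_n) :
  fopen U -> mxreg U A -> fopen [set x | U x /\ A x \in unitmx].
Proof.
move=> oU rA; have := fopen_neq0 oU (freg_det oU rA).
by congr fopen; apply/seteqP; split=> x /=; rewrite unitmxE unitfE.
Qed.

Lemma mxreg_inv X n (U : set X) (A : X -> 'M[K]_n) :
  fopen U -> (forall x, U x -> A x \in unitmx) -> mxreg U A ->
  mxreg U (fun x => invmx (A x)).
Proof.
move=> oU uA rA i j.
apply: (@freg_eq _ _ _ (fun x => (\det (A x))^-1 * cofactor (A x) j i)).
  by move=> x /uA uAx; rewrite /invmx uAx !mxE.
have rdet := freg_det oU rA.
apply: fregM => //.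
  have := fregV oU rdet; apply: freg_sub => //; first exact: fopen_neq0.
  by move=> x Ux; split=> //; rewrite -unitfE -unitmxE uA.
rewrite /cofactor; apply: fregM => //; first exact: freg_cst.
apply: freg_det => // k l; apply: freg_eq (rA (lift j k) (lift i l)) => x _.
by rewrite !mxE.
Qed.

Lemma mxreg_comp X Y (f : morphism X Y) m n (U : set Y)
    (A : Y -> 'M[K]_(m, n)) :
  fopen U -> mxreg U A -> mxreg (f @^-1` U) (A \o f).
Proof. by move=> oU rA i j; exact: morph_reg (rA i j). Qed.

End RegularMatrices.

Section BundleIsomorphisms.
Variable K : fieldType.
Implicit Types X Y : funspace K.

Lemma vb_transK X r (E : vbundle X r) p q x :
  vb_dom E p x -> vb_dom E q x -> vb_trans E p q x *m vb_trans E q p x = 1%:M.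
Proof. by move=> Ep Eq; rewrite vb_cocycle// vb_id. Qed.

Lemma vb_trans_unit X r (E : vbundle X r) p q x :
  vb_dom E p x -> vb_dom E q x -> vb_trans E p q x \in unitmx.
Proof. by move=> Ep Eq; have /mulmx1_unit[] := vb_transK Ep Eq. Qed.

Lemma vb_openI X r s (E : vbundle X r) (F : vbundle X s) p q :
  fopen (vb_dom E p `&` vb_dom F q).
Proof. by apply: fopenI; exact: vb_open. Qed.

(** Serves whenever two presentations share their cocycle up to shrinking the cover: the transition
    matrices of [E] are then themselves an isomorphism. *)
Lemma vb_iso_refine X r (E F : vbundle X r) :
  (forall p, vb_dom F p `<=` vb_dom E p) ->
  (forall p q x, vb_dom F p x -> vb_dom F q x ->
    vb_trans F p q x = vb_trans E p q x) ->
  vb_iso E F.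
Proof.
move=> sub eqt; exists (vb_trans E); split.
- move=> q p; apply: mxreg_sub (vb_reg E q p); try exact: vb_openI.
  by move=> x [/sub Eq Ep].
- by move=> q p x /sub; exact: vb_trans_unit.
- move=> q q' p' p x Fq Fq' Ep' Ep.
  by rewrite eqt// !vb_cocycle//; exact: sub.
Qed.

Lemma vb_iso_refl X r (E : vbundle X r) : vb_iso E E.
Proof. by apply: vb_iso_refine => [p x|p q x]. Qed.

Lemma vb_iso_sym X r (E F : vbundle X r) : vb_iso E F -> vb_iso F E.
Proof.
case=> h [rh uh eh]; exists (fun p q x => invmx (h q p x)); split.
- move=> p q; rewrite setIC; apply: mxreg_inv (rh q p).
    exact: vb_openI.
  by move=> x [Fq Ep]; exact: uh.
- by move=> p q x Ep Fq; rewrite unitmx_inv uh.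
- move=> p p' q' q x Ep Ep' Fq' Fq.
  have uq := uh _ _ _ Fq Ep; have uq' := uh _ _ _ Fq' Ep'.
  apply: (can_inj (mulmxK uq)); rewrite mulVmx// -(eh q q' p' p)//.
  rewrite -!mulmxA (mulmxA (vb_trans F q' q x)) vb_transK// mul1mx.
  by rewrite (mulmxA (invmx _)) mulVmx// mul1mx vb_transK.
Qed.

Lemma vb_iso_trans X r (E F G : vbundle X r) :
  vb_iso E F -> vb_iso F G -> vb_iso E G.
Proof.
case=> h [rh uh eh] [k [rk uk ek]].
have kh q p t t' x : vb_dom G q x -> vb_dom E p x -> vb_dom F t x ->
    vb_dom F t' x -> k q t x *m h t p x = k q t' x *m h t' p x.
  move=> Gq Ep Ft Ft'.
  rewrite -(ek q q t' t)// -(eh t t' p p)// !vb_id// mul1mx mulmx1.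
  by rewrite -mulmxA (mulmxA (vb_trans F t' t x)) vb_transK// mul1mx.
(* The composite passes through the chart of [F] centred at the current point. By [kh] any chart
   around that point gives the same product, so regularity is checked locally with the chart
   frozen. *)
exists (fun q p x => k q x x *m h x p x); split.
- move=> q p; have o : fopen (vb_dom G q `&` vb_dom E p).
    exact: vb_openI.
  apply: mxreg_glue => // x [Gq Ep].
  have oW := fopenI o (vb_open F x).
  exists (vb_dom G q `&` vb_dom E p `&` vb_dom F x); split=> //.
  + by split=> //; exact: vb_mem.
  + apply: (@mxreg_eq _ _ _ _ _ (fun y => k q x y *m h x p y)).
      by move=> y [[Gy Ey] Fy]; apply: kh => //; exact: vb_mem.
    apply: mxreg_mul => //.
      by apply: mxreg_sub (rk q x) => //; [exact: vb_openI|move=> y [[]]].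
    by apply: mxreg_sub (rh x p) => //; [exact: vb_openI|move=> y [[]]].
- by move=> q p x Gq Ep; rewrite unitmx_mul uk ?uh//; exact: vb_mem.
- move=> q q' p' p x Gq Gq' Ep' Ep; have Fx := vb_mem F x.
  rewrite -(ek q q' x x)// -(eh x x p' p)// !vb_id// mul1mx mulmx1.
  by rewrite !mulmxA.
Qed.

Lemma eq_iso_class X r (E F : vbundle X r) :
  iso_class E = iso_class F <-> vb_iso E F.
Proof.
split=> [EF|EF].
  by have : iso_class F F := vb_iso_refl F; rewrite -EF.
apply/seteqP; split=> G; apply: vb_iso_trans => //; exact: vb_iso_sym.
Qed.

Lemma det_line X (L : vbundle X 1) : vb_iso (det_bundle L) L.
Proof.
by apply: vb_iso_refine => [p x|p q x _ _] //;
  rewrite [RHS]/= det_mx11 -mx11_scalar.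
Qed.

Lemma pullback_iso X Y (f : morphism X Y) r (E F : vbundle Y r) :
  vb_iso E F -> vb_iso (pullback f E) (pullback f F).
Proof.
case=> h [rh uh eh]; exists (fun q p x => h (f q) (f p) (f x)); split.
- move=> q p; have := mxreg_comp f _ (rh (f q) (f p)); apply.
  exact: vb_openI.
- by move=> q p x; exact: uh.
- by move=> q q' p' p x; exact: eh.
Qed.

Lemma pullback_det X Y (f : morphism X Y) r (E : vbundle Y r) :
  vb_iso (det_bundle (pullback f E)) (pullback f (det_bundle E)).
Proof. by apply: vb_iso_refine => [p x|p q x]. Qed.

Lemma pullbackK X Y (f : morphism X Y) (g : morphism Y X) r (E : vbundle Y r) :
  cancel g f -> vb_iso (pullback g (pullback f E)) E.
Proof.
by move=> fK; apply: vb_iso_refine => [p x|p q x _ _] /=; rewrite !fK.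
Qed.

Lemma spanned_pullback X Y (f : morphism X Y) r (E : vbundle Y r) :
  spanned E -> spanned (pullback f E).
Proof.
move=> spE p x v /= Ep; have [s [rs es] sx] := spE (f p) (f x) v Ep.
exists (fun p x => s (f p) (f x)) => //; split=> [q|q t y Eq Et].
  by have := mxreg_comp f (vb_open E (f q)) (rs (f q)).
exact: es.
Qed.

(** A section is read in the chart of [E] centred at the point itself; by compatibility with
    transitions a fixed chart nearby gives the same image, hence regularity. *)
Lemma vb_iso_section X r (E F : vbundle X r) : vb_iso E F ->
  exists h : X -> X -> 'M[K]_r,
    (forall q x, vb_dom F q x -> h q x \in unitmx) /\
    (forall s, vb_section E s -> vb_section F (fun q x => h q x *m s x x)).
Proof.
case=> h [rh uh eh]; exists (fun q x => h q x x); split=> [q x Fq|s [rs es]].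
  by apply: uh => //; exact: vb_mem.
have hs q t t' y : vb_dom F q y -> vb_dom E t y -> vb_dom E t' y ->
    h q t y *m s t y = h q t' y *m s t' y.
  move=> Fq Et Et'; rewrite (es t t')// mulmxA; congr (_ *m _).
  by rewrite -(eh q q t t')// vb_id// mul1mx.
split=> [q|q t y Fq Ft].
  apply: mxreg_glue => [|y Fq]; first exact: vb_open.
  have oW := vb_openI F E q y.
  exists (vb_dom F q `&` vb_dom E y); split=> //.
  - by split=> //; exact: vb_mem.
  - apply: (@mxreg_eq _ _ _ _ _ (fun z => h q y z *m s y z)).
      by move=> z [Fz Ez]; apply: hs => //; exact: vb_mem.
    apply: mxreg_mul => //.
    by apply: mxreg_sub (rs y) => //; exact: vb_open.
have Ey := vb_mem E y.
by rewrite -(eh q t y y)// vb_id// mulmx1 -mulmxA.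
Qed.

Lemma c1_line X r (E : vbundle X r) (L : vbundle X 1) :
  c1 E = c1 L <-> vb_iso (det_bundle E) L.
Proof.
rewrite /c1 eq_iso_class; have LL := det_line L; split=> EL.
  exact: vb_iso_trans EL LL.
exact: vb_iso_trans EL (vb_iso_sym LL).
Qed.

Lemma class_map_pullback X Y (f : morphism X Y) r (E : vbundle Y r) :
  class_map (fun F : vbundle Y r => pullback f F) (iso_class E) =
  iso_class (pullback f E).
Proof.
apply/seteqP; split=> G; last by exists E => //; exact: vb_iso_refl.
by case=> F EF; apply: vb_iso_trans; exact: pullback_iso.
Qed.

End BundleIsomorphisms.

(** * Bundles along a contraction with a section *)

Section Frames.
Variables (K : fieldType) (X : funspace K) (r : nat) (E : vbundle X r).

(* A family of r global sections, as the columns of a square matrix. *)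
Definition mxsection (S : X -> X -> 'M[K]_r) : Prop :=
  (forall p, mxreg (vb_dom E p) (S p)) /\
  (forall p q x, vb_dom E p x -> vb_dom E q x ->
    S p x = vb_trans E p q x *m S q x).

(** The columns are global sections taking the standard basis vectors as values at [x]. *)
Lemma spanned_frame x :
  spanned E -> exists2 S, mxsection S & S x x \in unitmx.
Proof.
move=> spE.
have /fin_all_exists[s sP] (j : 'I_r) : exists s : X -> X -> 'cV[K]_r,
    vb_section E s /\ s x x = delta_mx j 0.
  by have [s ? ?] := spE x x (delta_mx j 0) (vb_mem E x); exists s.
exists (fun p y => \matrix_(i, j) s j p y i 0); first split.
- move=> p i j; have [[rs _] _] := sP j.
  by apply: freg_eq (rs p i 0) => y _; rewrite mxE.
- move=> p q y Ep Eq; apply/matrixP => i j; have [[_ es] _] := sP j.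
  by rewrite mxE (es p q)// !mxE; apply: eq_bigr => k _; rewrite mxE.
- suff -> : \matrix_(i, j) s j x x i 0 = 1%:M by exact: unitmx1.
  by apply/matrixP => i j; rewrite mxE (sP j).2 !mxE eqxx andbT.
Qed.

Lemma mxsection_unit S p q x : mxsection S -> vb_dom E p x -> vb_dom E q x ->
  (S p x \in unitmx) = (S q x \in unitmx).
Proof.
by move=> [_ eS] Ep Eq; rewrite (eS p q)// unitmx_mul vb_trans_unit.
Qed.

Lemma mxsection_det S : mxsection S ->
  vb_section (det_bundle E) (fun p x => (\det (S p x))%:M).
Proof.
case=> rS eS; split=> [p i j|p q x Ep Eq].
  apply: freg_eq (freg_det (vb_open E p) (rS p)).
  by move=> x _; rewrite !ord1 mxE eqxx mulr1n.
by rewrite /= -scalar_mxM -det_mulmx -eS.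
Qed.

End Frames.

(* [X] is covered by images of spaces without nonconstant global functions,
   contracted by [f], each of which joins a point [x] to [g (f x)]. *)
Section Contraction.
Variables (K : fieldType) (X Y : funspace K).
Variables (f : morphism X Y) (g : morphism Y X).
Hypothesis gK : cancel g f.
Hypothesis fibres : forall x,
  exists (Z : funspace K) (j : morphism Z X) (u v : Z),
  [/\ forall phi : Z -> K, freg setT phi -> forall z z', phi z = phi z',
      forall z, f (j z) = f x, j u = x & j v = g (f x)].

(** Since [j] lands in the fibre, the entries of [A] pull back to global regular functions on [Z],
    which are constant; [j] attains both [x] and [g (f x)]. *)
Lemma fibre_constant m n x (U : set X) (A : X -> 'M[K]_(m, n)) : fopen U ->
  (forall y, f y = f x -> U y) -> mxreg U A -> A x = A (g (f x)).
Proof.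
move=> oU sub rA; have [Z [j [u [v [cZ fj ju jv]]]]] := fibres x.
rewrite -jv -[in LHS]ju; apply/matrixP => a b.
apply: (cZ (fun z => A (j z) a b)); have := morph_reg j oU (rA a b).
apply: freg_sub; [exact: morph_open|exact: fopenT|].
by move=> z _; exact: sub.
Qed.

(** * Descent of a spanned bundle whose determinant comes from the base *)

Section Descent.
Variables (r : nat) (E : vbundle X r) (L : vbundle Y 1).
Hypothesis detE : vb_iso (det_bundle E) (pullback f L).

(** The isomorphism [detE] turns the determinant of [S] into a section of [pullback f L]. A chart of
    that bundle contains the whole fibre, so there the section is a function constant along the
    fibre, and it vanishes exactly where [S] fails to be a frame. *)
Lemma frame_fibre S x y : mxsection E S -> f y = f x ->
  (S x x \in unitmx) = (S y y \in unitmx).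
Proof.
move=> SE yx.
(* Points of one fibre are compared through their common point [g (f x)]. *)
wlog -> : x y yx / y = g (f x) => [wl|].
  by rewrite (wl x (g (f x))) ?gK// (wl y (g (f y))) ?gK// yx.
have [h [uh /(_ _ (mxsection_det SE)) [rt _]]] := vb_iso_section detE.
have /= t_cst := @fibre_constant _ _ x _ _ (vb_open (pullback f L) x) _ (rt x).
have fx : vb_dom L (f x) (f x) := vb_mem L (f x).
have : (h x x *m (\det (S x x))%:M) \in unitmx =
   ((h x (g (f x)) *m (\det (S (g (f x)) (g (f x))))%:M) \in unitmx).
  by rewrite t_cst// => z ->.
rewrite !unitmx_mul !uh//=; last by rewrite gK.
by rewrite !unitmxE !det_scalar1.
Qed.

(** By [frame_fibre] the open locus [U] where [S] is a frame contains the whole fibre, and on it the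
    change of frame is regular, hence constant along the fibre. *)
Lemma frame_change S T x : mxsection E S -> mxsection E T -> S x x \in unitmx ->
  invmx (S x x) *m T x x =
  invmx (S (g (f x)) (g (f x))) *m T (g (f x)) (g (f x)).
Proof.
move=> SE TE uS; set y := g (f x).
pose V p := [set z | vb_dom E p z /\ S p z \in unitmx].
have oV p : fopen (V p) by apply: fopen_unit; [exact: vb_open|exact: SE.1].
pose U := [set z | S z z \in unitmx].
have VU p : V p `<=` U.
  by move=> z [Ep uz]; rewrite /U /= -(mxsection_unit SE Ep (vb_mem E z)).
have oU : fopen U.
  apply: fopen_local => z uz; exists (V z); split=> //.
  by split=> //; exact: vb_mem.
apply: (@fibre_constant _ _ x U (fun z => invmx (S z z) *m T z z)) => //.
  by move=> z zx; rewrite /U /= -(@frame_fibre S x z).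
apply: mxreg_glue => // z uz; exists (V z); split=> //.
  by split=> //; exact: vb_mem.
(* Transition matrices cancel between the inverse of [S] and [T], so the fixed chart at [z] may
   replace the moving one. *)
apply: (@mxreg_eq _ _ _ _ _ (fun w => invmx (S z w) *m T z w)).
  move=> w [Ez uzw]; have Ew := vb_mem E w.
  rewrite (SE.2 z w)// (TE.2 z w)//.
  have ut := vb_trans_unit Ez Ew; have uSw : S w w \in unitmx by exact: (VU z).
  have uSz : vb_trans E z w w *m S w w \in unitmx by rewrite unitmx_mul ut.
  by apply: (can_inj (mulKmx uSz)); rewrite mulKVmx// -mulmxA mulKVmx.
apply: mxreg_mul => //.
  apply: mxreg_inv => //; first by move=> w [].
  by apply: mxreg_sub (SE.1 z) => //; [exact: vb_open|move=> w []].
by apply: mxreg_sub (TE.1 z) => //; [exact: vb_open|move=> w []].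
Qed.

Theorem spanned_descent : spanned E -> vb_iso E (pullback f (pullback g E)).
Proof.
move=> spE.
have /choice[fr frP] y : exists S, mxsection E S /\ S y y \in unitmx.
  by have [S ? ?] := spanned_frame y spE; exists S.
pose k (S : X -> X -> 'M[K]_r) (q p x : X) :=
  S (g (f q)) (g (f x)) *m invmx (S p x).
(* The overlap of chart [q] of [pullback f (pullback g E)] with chart [p] of [E]. *)
pose D q p := [set x | vb_dom E (g (f q)) (g (f x)) /\ vb_dom E p x].
have fr_unit S x p : mxsection E S -> S (g (f x)) (g (f x)) \in unitmx ->
    vb_dom E p x -> S p x \in unitmx.
  move=> SE uS Ep; rewrite (mxsection_unit SE Ep (vb_mem E x)).
  by rewrite (@frame_fibre _ _ (g (f x))) ?gK.
(* With the same [C] at [x] and at [g (f x)], replacing [S] by [T = S C] makes [C] cancel in [k]. *)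
have kE S T q p x : mxsection E S -> mxsection E T ->
    S (g (f x)) (g (f x)) \in unitmx -> T (g (f x)) (g (f x)) \in unitmx ->
    D q p x -> k S q p x = k T q p x.
  move=> SE TE uS uT [Eq Ep].
  have Ex := vb_mem E x; have Eg := vb_mem E (g (f x)).
  have uSx := fr_unit _ _ _ SE uS Ex; have uTx := fr_unit _ _ _ TE uT Ex.
  have uSp := fr_unit _ _ _ SE uS Ep; have uTp := fr_unit _ _ _ TE uT Ep.
  have TS : T x x = S x x *m (invmx (S x x) *m T x x) by rewrite mulKVmx.
  have := frame_change SE TE uSx.
  set C := invmx (S x x) *m _ in TS *; move=> CE.
  have TSg : T (g (f x)) (g (f x)) = S (g (f x)) (g (f x)) *m C.
    by rewrite CE mulKVmx.
  have TSp : T p x = S p x *m C.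
    by rewrite (TE.2 _ _ _ Ep Ex) TS mulmxA -(SE.2 _ _ _ Ep Ex).
  rewrite /k (SE.2 _ _ _ Eq Eg) (TE.2 _ _ _ Eq Eg) TSg.
  by apply: (can_inj (mulmxK uTp)); rewrite mulmxKV// TSp !mulmxA mulmxKV.
(* The chosen frame moves with [x]; by [kE] it can be frozen on the open set where one fixed [S]
   remains a frame, which gives regularity. *)
exists (fun q p x => k (fr (g (f x))) q p x); split.
- move=> q p; have oD : fopen (D q p).
    exact: fopenI (morph_open f (morph_open g (vb_open E _))) (vb_open E p).
  apply: (@mxreg_glue _ _ _ _ (D q p)) => // x [Eq Ep].
  have [SE uS] := frP (g (f x)); set S := fr _ in SE uS.
  have rS : mxreg (D q p) (fun y => S (g (f q)) (g (f y))).
    have oEq := vb_open E (g (f q)).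
    have := mxreg_comp f (morph_open g oEq) (mxreg_comp g oEq (SE.1 (g (f q)))).
    by apply: mxreg_sub => //; [do 2 apply: morph_open => //|move=> y []].
  have oV := fopen_unit oD rS.
  have VS y : D q p y -> S (g (f q)) (g (f y)) \in unitmx ->
      S (g (f y)) (g (f y)) \in unitmx.
    by move=> [Ey _]; rewrite (mxsection_unit SE Ey (vb_mem E _)).
  exists [set y | D q p y /\ S (g (f q)) (g (f y)) \in unitmx]; split=> //.
  + by split=> //; rewrite (mxsection_unit SE Eq (vb_mem E _)).
  + by move=> y [].
  apply: (@mxreg_eq _ _ _ _ _ (k S q p)).
    move=> y [Dy uy]; have [TE uT] := frP (g (f y)).
    by apply: kE => //; exact: VS.
  apply: mxreg_mul => //; first by apply: mxreg_sub rS => // y [].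
  apply: mxreg_inv => // [y [Dy uy]|].
    by apply: (fr_unit _ y) => //; [exact: VS|exact: Dy.2].
  by apply: mxreg_sub (SE.1 p) => //; [exact: vb_open|move=> y [[]]].
- move=> q p x Eq Ep; have [SE uS] := frP (g (f x)).
  rewrite unitmx_mul unitmx_inv (fr_unit _ x)// andbT.
  by rewrite (mxsection_unit SE Eq (vb_mem E _)).
- move=> q q' p' p x Eq Eq' Ep' Ep; have [SE uS] := frP (g (f x)).
  rewrite /k (SE.2 (g (f q)) (g (f q')))// -!mulmxA; do 2 congr (_ *m _).
  apply: (can_inj (mulKmx (fr_unit _ _ _ SE uS Ep'))).
  rewrite mulKVmx ?(fr_unit _ x)//.
  apply: (can_inj (mulmxK (fr_unit _ _ _ SE uS Ep))).
  by rewrite mulmxKV ?(fr_unit _ x)// -SE.2.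
Qed.

End Descent.

(** Pulling back along the section [g] undoes pulling back along [f], which gives injectivity;
    surjectivity is [spanned_descent], with [pullback g E] as preimage. *)
Theorem pullback_bij r (L : vbundle Y 1) (M : vbundle X 1) :
  vb_iso (pullback f L) M ->
  set_bij (iso_classes [set F : vbundle Y r | spanned F /\ c1 F = c1 L])
          (iso_classes [set E : vbundle X r | spanned E /\ c1 E = c1 M])
          (class_map (fun F : vbundle Y r => pullback f F)).
Proof.
move=> LM; split.
- move=> _ [F [spF c1F] <-]; exists (pullback f F).
    split; first exact: spanned_pullback.
    apply/c1_line; apply: vb_iso_trans (pullback_det f F) _.
    by apply: vb_iso_trans (pullback_iso f _) LM; apply/c1_line.
  by rewrite class_map_pullback.
- move=> _ _ /set_mem[F _ <-] /set_mem[G _ <-].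
  rewrite !class_map_pullback => /eq_iso_class/(pullback_iso g) FG.
  apply/eq_iso_class; apply: vb_iso_trans (vb_iso_sym (pullbackK F gK)) _.
  exact: vb_iso_trans FG (pullbackK G gK).
- move=> _ [E [spE /c1_line c1E] <-].
  have detE : vb_iso (det_bundle E) (pullback f L).
    exact: vb_iso_trans c1E (vb_iso_sym LM).
  have Ef := spanned_descent detE spE.
  exists (iso_class (pullback g E)); last first.
    by rewrite class_map_pullback; apply/eq_iso_class; exact: vb_iso_sym.
  exists (pullback g E) => //; split; first exact: spanned_pullback.
  apply/c1_line; apply: vb_iso_trans (pullback_det g E) _.
  exact: vb_iso_trans (pullback_iso g detE) (pullbackK L gK).
Qed.

End Contraction.

(** * Regular functions on projective space *)

Section Polynomials.
Variable K : closedFieldType.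
Implicit Types p q F G : {poly K}.

Lemma poly_eq_cofinite q F G :
  q != 0 -> (forall t, q.[t] != 0 -> F.[t] = G.[t]) -> F = G.
Proof.
move=> q0 eqFG; apply/eqP; rewrite -subr_eq0; apply: contraT => FG0.
have /closed_nonrootP[t] : q * (F - G) != 0 by rewrite mulf_neq0.
rewrite rootM negb_or !rootE => /andP[qt].
by rewrite !hornerE eqFG// subrr eqxx.
Qed.

(** Reduce the fraction found at 0 to lowest terms [p / q]. Every other local fraction agrees with
    it as a rational function, so [q] divides its denominator. Thus [q] has no root and is
    constant. *)
Lemma locally_rational_polynomial (f : K -> K) :
  (forall t0, exists p q, q.[t0] != 0 /\
    forall t, q.[t] != 0 -> f t = p.[t] / q.[t]) ->
  exists F, forall t, f t = F.[t].
Proof.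
move=> ratf; have [p0 [q0 [q00 e0]]] := ratf 0.
have q0n : q0 != 0 by apply: contraNneq q00 => ->; rewrite horner0.
pose d := gcdp p0 q0.
have d0 : d != 0 by rewrite gcdp_eq0 negb_and q0n orbT.
pose p := p0 %/ d; pose q := q0 %/ d.
have p0E : p0 = p * d by rewrite divpK// dvdp_gcdl.
have q0E : q0 = q * d by rewrite divpK// dvdp_gcdr.
have cqp : coprimep q p by rewrite coprimep_sym coprimep_div_gcd// q0n orbT.
have q_neq0 t : q.[t] != 0 /\ f t = p.[t] / q.[t].
  have [p1 [q1 [q1t e1]]] := ratf t.
  have q1n : q1 != 0 by apply: contraNneq q1t => ->; rewrite horner0.
  have E : p * q1 = p1 * q.
    apply: (mulIf d0); rewrite mulrAC -p0E -mulrA -q0E.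
    apply: (@poly_eq_cofinite (q0 * q1)); first exact: mulf_neq0.
    move=> s; rewrite !hornerM mulf_eq0 negb_or => /andP[q0s q1s].
    by apply/eqP; rewrite -eqr_div// -e0// -e1.
  have /dvdpP[k q1E] : q %| q1 by rewrite -(Gauss_dvdpr q1 cqp) E dvdp_mulIr.
  have qt : q.[t] != 0.
    by apply: contraNneq q1t => qt; rewrite q1E hornerM qt mulr0.
  split=> //; rewrite e1//; apply/eqP; rewrite eqr_div//.
  by rewrite -!hornerM E.
have /size_poly1P[c c0 qc] : size q == 1%N.
  by apply: contraT => /closed_rootP[t]; rewrite rootE (negbTE (q_neq0 t).1).
exists (c^-1 *: p) => t; rewrite (q_neq0 t).2 qc hornerC hornerZ mulrC//.
Qed.

Lemma poly_inv_size F G :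
  (forall t, t != 0 -> F.[t] = G.[t^-1]) -> (size F <= 1)%N.
Proof.
(* [R] is [X^N G(1/X)], of degree at most [N]; equality with [F X^N] forces [F] to have degree at
   most 0. *)
move=> FG; pose N := size G; pose R := \sum_(i < N) G`_i *: 'X^(N - i).
have FR : F * 'X^N = R.
  apply: (@poly_eq_cofinite 'X); first by rewrite polyX_eq0.
  move=> t; rewrite hornerX => t0; rewrite !hornerE FG// horner_coef.
  rewrite mulr_suml horner_sum; apply: eq_bigr => i _.
  by rewrite !hornerE -mulrA exprVn [_^-1 * _]mulrC expfB.
have [->|F0] := eqVneq F 0; first by rewrite size_poly0.
rewrite -(leq_add2l N) -(size_mulXn _ F0) FR addn1.
apply: (leq_trans (size_sum _ _ _)); apply/bigmax_leqP => i _.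
by apply: leq_trans (size_scale_leq _ _) _; rewrite size_polyXn ltnS leq_subr.
Qed.

Lemma poly_inv_constant F G :
  (forall t, t != 0 -> F.[t] = G.[t^-1]) -> F.[0] = G.[0].
Proof.
move=> FG; have /size1_polyC FC := poly_inv_size FG.
have /size1_polyC GC : (size G <= 1)%N.
  apply: (@poly_inv_size _ F) => t t0.
  by rewrite FG ?invrK// invr_eq0.
have := FG 1 (oner_neq0 _).
by rewrite FC GC !hornerC.
Qed.

End Polynomials.

Section ProjectiveConstants.
Variables (K : closedFieldType) (n : nat).
Local Notation P := (proj_space K n).

Lemma meval_dhomogZ (p : {mpoly K[n.+1]}) d c (v : 'I_n.+1 -> K) :
  p \is d.-homog -> p.@[fun i => c * v i] = c ^+ d * p.@[v].
Proof.
move=> /dhomogP hp; rewrite !mevalE mulr_sumr !big_seq; apply: eq_bigr => m mp.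
rewrite mulrCA; congr (_ * _).
under eq_bigr do rewrite exprMn.
by rewrite big_split /= -expr_sum -(hp m mp) /= mdegE.
Qed.

Lemma meval_line (p : {mpoly K[n.+1]}) (v w : 'I_n.+1 -> K) :
  exists F : {poly K}, forall t, F.[t] = p.@[fun i => v i + t * w i].
Proof.
exists (\sum_(m <- msupp p) p@_m *: \prod_i ((v i)%:P + w i *: 'X) ^+ m i) => t.
rewrite mevalE horner_sum; apply: eq_bigr => m _; rewrite hornerZ horner_prod.
by congr (_ * _); apply: eq_bigr => i _; rewrite !hornerE mulrC.
Qed.

Lemma line_vspan (L : P) u : u \in val L -> u != 0 -> val L = <[u]>%VS.
Proof.
move=> uL u0; apply/esym/eqP; rewrite eqEdim -memvE uL.
by rewrite (eqP (valP L)) dim_vline u0.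
Qed.

Variable (A : P).

(* The line spanned by [u]; the junk value [A] is taken at [u = 0]. *)
Definition point (u : 'rV[K]_n.+1) : P := insubd (A : pspace K n) <[u]>%VS.

Lemma val_point u : u != 0 -> val (point u) = <[u]>%VS.
Proof. by move=> u0; rewrite val_insubd dim_vline u0. Qed.

Lemma pointE u (L : P) : u \in val L -> u != 0 -> point u = L.
Proof.
by move=> uL u0; apply: val_inj; rewrite val_point// -(line_vspan uL).
Qed.

(** The representative picked by [hcoord] is a nonzero multiple [c] of [u]; numerator and
    denominator have the same degree [d], so the factors [c ^+ d] cancel. *)
Lemma freg_point (phi : P -> K) (u0 : 'rV[K]_n.+1) : freg setT phi -> u0 != 0 ->
  exists p q : {mpoly K[n.+1]}, q.@[u0 0] != 0 /\
    forall u : 'rV[K]_n.+1, u != 0 -> q.@[u 0] != 0 ->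
      phi (point u) = p.@[u 0] / q.@[u 0].
Proof.
move=> rphi u00; have [d [p [q [hp hq q0 e]]]] := rphi (point u0) I.
have hvalE (u : 'rV[K]_n.+1) : u != 0 -> exists2 c, c != 0 &
    forall s, s \is d.-homog -> hval s (point u) = c ^+ d * s.@[u 0].
  move=> un0; have /vlineP[c cE] : vpick (val (point u)) \in <[u]>%VS.
    by rewrite -val_point// memv_pick.
  exists c => [|s hs].
    apply/eqP => c0; move: cE => /eqP.
    by rewrite c0 scale0r vpick0 val_point// -dimv_eq0 dim_vline un0.
  rewrite -meval_dhomogZ//; apply: meval_eq => i.
  by rewrite /hcoord cE mxE.
have [c c0 hc] := hvalE _ u00.
exists p, q; split.
  by move: q0; rewrite hc// mulf_eq0 negb_or => /andP[].
move=> u un0 qu; have [b b0 hb] := hvalE _ un0.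
by rewrite e//= !hb ?mulf_neq0 ?expf_neq0// -mulf_div divff ?mul1r// expf_neq0.
Qed.

Lemma freg_line (phi : P -> K) (v w : 'rV[K]_n.+1) : freg setT phi ->
  (forall t, v + t *: w != 0) ->
  exists F : {poly K}, forall t, phi (point (v + t *: w)) = F.[t].
Proof.
move=> rphi vw0; apply: locally_rational_polynomial => t0.
have [p [q [q0 e]]] := freg_point rphi (vw0 t0).
have lineE (s : {mpoly K[n.+1]}) t :
    s.@[fun i => v 0 i + t * w 0 i] = s.@[(v + t *: w) 0].
  by apply: meval_eq => i; rewrite !mxE.
have [Fp Fpe] := meval_line p (v 0) (w 0).
have [Fq Fqe] := meval_line q (v 0) (w 0).
exists Fp, Fq; rewrite Fqe lineE; split=> // t.
by rewrite Fqe Fpe !lineE; exact: e.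
Qed.

Lemma freg_proj_constant (phi : P -> K) : freg setT phi ->
  forall L M : P, phi L = phi M.
Proof.
move=> rphi L M; case: (pselect (L = M)) => [->//|LM].
have pick0 (N : P) : vpick (val N) != 0.
  by rewrite vpick0 -dimv_eq0 (eqP (valP N)).
set v := vpick (val L); set w := vpick (val M).
have v0 : v != 0 := pick0 L. have w0 : w != 0 := pick0 M.
(* Representatives of distinct points are not proportional, so the affine line through them avoids
   the origin. *)
have free (N N' : P) t : N <> N' -> vpick (val N) + t *: vpick (val N') != 0.
  move=> NN'; apply/eqP => /eqP; rewrite addr_eq0 => /eqP NE; apply: NN'.
  rewrite -(pointE (memv_pick _) (pick0 N)); apply: pointE => //.
  by rewrite NE rpredN rpredZ// memv_pick.
have [F FE] := freg_line rphi (free L M ^~ LM).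
have [G GE] := freg_line rphi (free M L ^~ (nesym LM)).
have := FE 0; have := GE 0; rewrite !scale0r !addr0.
rewrite !(pointE (memv_pick _))// => -> ->; apply: poly_inv_constant => t t0.
(* For nonzero [t], [v + t w] is [t] times [w + t^-1 v]: both give the same point. *)
rewrite -FE -GE; congr phi; apply: pointE; last exact: free.
rewrite val_point ?free//; last exact: nesym.
apply/vlineP; exists t; rewrite scalerDr scalerA mulfV// scale1r addrC//.
Qed.

End ProjectiveConstants.

(** * Morphisms into products *)

Section Pairing.
Variable K : fieldType.
Implicit Types X Y Z : funspace K.

Definition id_morphism X : morphism X X :=
  @Morphism K X X id (fun V oV => oV) (fun V phi oV rphi => rphi).

Lemma cst_open X Y (y0 : Y) (V : set Y) :
  fopen V -> fopen ((fun=> y0) @^-1` V : set X).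
Proof.
move=> oV; apply: fopen_local => x Vy; exists setT; split=> //.
exact: fopenT.
Qed.

Lemma cst_reg X Y (y0 : Y) (V : set Y) (phi : Y -> K) :
  fopen V -> freg V phi -> freg ((fun=> y0) @^-1` V : set X) (phi \o fun=> y0).
Proof. by move=> oV _; apply: freg_cst; exact: cst_open. Qed.

Definition cst_morphism X Y (y0 : Y) : morphism X Y :=
  Morphism (@cst_open X Y y0) (@cst_reg X Y y0).

Section Pair.
Variables (X Y Z : funspace K) (f : morphism X Y) (g : morphism X Z).

Lemma tensfun_pair (U : set Y) (V : set Z) D :
  fopen U -> fopen V -> tensfun U V D ->
  freg (f @^-1` U `&` g @^-1` V) (fun x => D (f x, g x)).
Proof.
move=> oU oV [I [a [b [ra rb e]]]].
have oUf := morph_open f oU; have oVg := morph_open g oV.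
have o := fopenI oUf oVg.
apply: (@freg_eq _ _ _ (fun x => \sum_i a i (f x) * b i (g x))).
  by move=> x [Ux Vx]; rewrite e.
apply: freg_sum => // i; apply: fregM => //.
  by have := morph_reg f oU (ra i); apply: freg_sub => // x [].
by have := morph_reg g oV (rb i); apply: freg_sub => // x [].
Qed.

(** A basic open set of the product, the locus [D != 0] in a box, pulls back to the nonvanishing
    locus of a regular function. *)
Lemma pair_open (W : set (prod_space Y Z)) :
  fopen W -> fopen ((fun x => (f x, g x)) @^-1` W).
Proof.
move=> oW; apply: fopen_local => x /oW[U [V [D [[oU oV] [Ux Vx] tD Dx sW]]]].
have o := fopenI (morph_open f oU) (morph_open g oV).
exists [set y | (f @^-1` U `&` g @^-1` V) y /\ D (f y, g y) != 0].
split=> //; first exact: fopen_neq0 o (tensfun_pair oU oV tD).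
by move=> y [[Uy Vy] Dy]; exact: sW.
Qed.

Lemma pair_reg (W : set (prod_space Y Z)) (phi : prod_space Y Z -> K) :
  fopen W -> freg W phi ->
  freg ((fun x => (f x, g x)) @^-1` W) (phi \o fun x => (f x, g x)).
Proof.
move=> oW rphi; have oW' := pair_open oW.
apply: freg_glue => // x Wx.
have [U [V [N [D [[oU oV] [Ux Vx] [tN tD] Dx e]]]]] := rphi _ Wx.
have o := fopenI (morph_open f oU) (morph_open g oV).
have rN := tensfun_pair oU oV tN; have rD := tensfun_pair oU oV tD.
set B := _ `&` _ in o rN rD.
have oD := fopen_neq0 o rD; have oWD := fopenI oW' oD.
exists ((fun x => (f x, g x)) @^-1` W `&`
        [set y | B y /\ D (f y, g y) != 0]); split=> //.
apply: (@freg_eq _ _ _ (fun y => N (f y, g y) * (D (f y, g y))^-1)).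
  by move=> y [Wy [[Uy Vy] Dy]]; rewrite /= e.
apply: fregM => //; first by apply: freg_sub rN => // y [_ []].
by have := fregV o rD; apply: freg_sub => // y [].
Qed.

Definition pair_morphism : morphism X (prod_space Y Z) :=
  Morphism pair_open pair_reg.

End Pair.

Lemma tensor_line_trivial_r X (L M : vbundle X 1) :
  (forall p q x, vb_dom M p x -> vb_dom M q x -> vb_trans M p q x = 1%:M) ->
  vb_iso L (tensor_line L M).
Proof.
by move=> M1; apply: vb_iso_refine => [p x []|p q x [_ Mp] [_ Mq]] //=;
  rewrite M1// mulmx1.
Qed.

Lemma tensor_line_trivial_l X (L M : vbundle X 1) :
  (forall p q x, vb_dom L p x -> vb_dom L q x -> vb_trans L p q x = 1%:M) ->
  vb_iso M (tensor_line L M).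
Proof.
by move=> L1; apply: vb_iso_refine => [p x []|p q x [Lp _] [Lq _]] //=;
  rewrite L1// mul1mx.
Qed.

End Pairing.

(** * The two projections of a product of projective spaces *)

Section ProjectiveProjections.
Variables (K : closedFieldType) (m n : nat).
Local Notation P1 := (proj_space K m).
Local Notation P2 := (proj_space K n).

Lemma proj_space_point k : inhabited (proj_space K k).
Proof.
have d1 : \dim <[const_mx 1 : 'rV[K]_k.+1]>%VS == 1%N.
  rewrite dim_vline eqb1; apply/eqP => /matrixP/(_ 0 0)/eqP.
  by rewrite !mxE oner_eq0.
exact: inhabits (exist (fun L => is_true (\dim L == 1%N)) _ d1).
Qed.

Lemma pullback_fst_bij r a :
  set_bij (iso_classes [set F : vbundle P1 r | spanned F /\ c1_is F a])
    (iso_classes [set E | spanned E /\ c1_is2 (m := m) (n := n) E a 0])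
    (class_map (fun F : vbundle P1 r => pullback (prod_fst P1 P2) F)).
Proof.
have [y0] := proj_space_point n.
(* The section is [x |-> (x, y0)]; the fibre through [(x, y)] is a copy of [P2] joining [y] to
   [y0]. *)
pose g := pair_morphism (id_morphism P1) (cst_morphism P1 (y0 : P2)).
apply: (@pullback_bij _ _ _ _ g) => //.
- move=> [x y]; exists P2.
  exists (pair_morphism (cst_morphism P2 x) (id_morphism P2)), y, y0.
  by split=> //; exact: freg_proj_constant.
(* The second factor comes from [O(0)], whose transition functions are zeroth powers and so reduce
   to 1. *)
- exact: tensor_line_trivial_r.
Qed.

Lemma pullback_snd_bij r b :
  set_bij (iso_classes [set F : vbundle P2 r | spanned F /\ c1_is F b])
    (iso_classes [set E | spanned E /\ c1_is2 (m := m) (n := n) E 0 b])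
    (class_map (fun F : vbundle P2 r => pullback (prod_snd P1 P2) F)).
Proof.
have [x0] := proj_space_point m.
pose g := pair_morphism (cst_morphism P2 (x0 : P1)) (id_morphism P2).
apply: (@pullback_bij _ _ _ _ g) => //.
- move=> [x y]; exists P1.
  exists (pair_morphism (id_morphism P1) (cst_morphism P1 y)), x, x0.
  by split=> //; exact: freg_proj_constant.
- exact: tensor_line_trivial_l.
Qed.

End ProjectiveProjections.

Theorem corollary2p8 (K : closedFieldType) (charK0 : [pchar K] =i pred0)
    (r a b : nat) (r_gt0 : (0 < r)%N) :
  let P1 := proj_space K 1 in
  let P2 := proj_space K 2 in
  let X := prod_space P1 P2 in
  let pi1 : morphism X P1 := prod_fst P1 P2 in
  let pi2 : morphism X P2 := prod_snd P1 P2 in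
  set_bij
    (iso_classes [set F : vbundle P1 r | spanned F /\ c1_is F a])
    (iso_classes [set E : vbundle X r | spanned E /\ c1_is2 E a 0])
    (class_map (fun F : vbundle P1 r => pullback pi1 F))
  /\
  set_bij
    (iso_classes [set F : vbundle P2 r | spanned F /\ c1_is F b])
    (iso_classes [set E : vbundle X r | spanned E /\ c1_is2 E 0 b])
    (class_map (fun F : vbundle P2 r => pullback pi2 F)).
Proof. by split; [exact: pullback_fst_bij|exact: pullback_snd_bij]. Qed.
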